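(* Let $(H,\mu,\Delta,\alpha,R)$ be a cobraided Hom-bialgebra over $\mathbf{k}$. (1) Then $H^n = (H,\mu^{(n)},\Delta^{(n)},\alpha^{2^n},R)$ is a cobraided Hom-bialgebra for each integer $n \geq 0$, where $\mu^{(n)} = \alpha^{2^n-1}\circ\mu$ and $\Delta^{(n)} = \Delta \circ \alpha^{2^n-1}$. (2) If $\alpha$ is injective, then $H^{n,k} = (H,\mu^{(n)},\Delta^{(n)},\alpha^{2^n},R^{\alpha^k})$ is a cobraided Hom-bialgebra for each pair of integers $n,k \geq 0$, where $R^{\alpha^k} = R \circ (\alpha^k \otimes \alpha^k)$.
   Context: $\mathbf{k}$ is a fixed associative and commutative ring of characteristic $0$; modules, tensor products and linear maps are over $\mathbf{k}$. For a self-map $\alpha$, $\alpha^n$ is the $n$-fold composition, $\alpha^0 = Id$. $\tau(v\otimes w)=w\otimes v$ is the twist isomorphism. Multiplication $\mu(x,y)$ is written $xy$; $\Delta(x)=\sum_{(x)} x_1\otimes x_2$ is Sweedler's notation. A Hom-associative algebra $(A,\mu,\alpha)$ is a $\mathbf{k}$-module $A$ with linear maps $\mu\colon A^{\otimes 2}\to A$, $\alpha\colon A\to A$ such that $\alpha\circ\mu=\mu\circ\alpha^{\otimes 2}$ and $\mu\circ(\alpha\otimes\mu)=\mu\circ(\mu\otimes\alpha)$. A Hom-coassociative coalgebra $(C,\Delta,\alpha)$ is a $\mathbf{k}$-module $C$ with linear maps $\Delta\colon C\to C^{\otimes 2}$, $\alpha\colon C\to C$ such that $\alpha^{\otimes 2}\circ\Delta=\Delta\circ\alpha$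 and $(\alpha\otimes\Delta)\circ\Delta=(\Delta\otimes\alpha)\circ\Delta$. A Hom-bialgebra $(H,\mu,\Delta,\alpha)$ is such that $(H,\mu,\alpha)$ is a Hom-associative algebra, $(H,\Delta,\alpha)$ is a Hom-coassociative coalgebra, and $\Delta\circ\mu=\mu^{\otimes 2}\circ(Id\otimes\tau\otimes Id)\circ\Delta^{\otimes 2}$. No units or counits are required. A cobraided Hom-bialgebra is a quintuple $(H,\mu,\Delta,\alpha,R)$ in which $(H,\mu,\Delta,\alpha)$ is a Hom-bialgebra and $R\colon H^{\otimes 2}\to\mathbf{k}$ is a linear map (a bilinear form on $H$) satisfying, for all $x,y,z\in H$: $R(xy\otimes\alpha(z))=\sum_{(z)}R(\alpha(x)\otimes z_1)R(\alpha(y)\otimes z_2)$; $R(\alpha(x)\otimes yz)=\sum_{(x)}R(x_1\otimes\alpha(z))R(x_2\otimes\alpha(y))$; $\sum_{(x)(y)}y_1x_1R(x_2\otimes y_2)=\sum_{(x)(y)}R(x_1\otimes y_1)x_2y_2$. *)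

(* Defs.v *)
From HB Require Import structures.
From mathcomp Require Import all_boot all_algebra.
From mathcomp Require Import boolp.
From mathcomp Require Import freeg.

Set Implicit Arguments.
Unset Strict Implicit.
Unset Printing Implicit Defensive.

Import GRing.Theory.

Local Open Scope ring_scope.
Local Open Scope quotient_scope.

HB.instance Definition _ (R : nzRingType) (X : choiceType) (M : lmodType R)
    (f : X -> M) :=
  GRing.isZmodMorphism.Build {freeg X / R} M (fglift f) (lift_is_additive f).

Section TensorProduct.
Variables (K : comNzRingType) (V W : lmodType K).

Local Notation free := {freeg (V * W)%type / K}.
Local Notation gen v w := (Freeg [:: (1 : K, (v, w))] : free).

(* The submodule of the free module on V * W generated by the bilinearity
   relations. *)
Inductive bilin_rel : free -> Prop :=
| bilin_rel_addl v v' w : bilin_rel (gen (v + v') w - gen v w - gen v' w)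
| bilin_rel_addr v w w' : bilin_rel (gen v (w + w') - gen v w - gen v w')
| bilin_rel_scalel (a : K) v w : bilin_rel (gen (a *: v) w - a *: gen v w)
| bilin_rel_scaler (a : K) v w : bilin_rel (gen v (a *: w) - a *: gen v w)
| bilin_rel0 : bilin_rel 0
| bilin_relD x y : bilin_rel x -> bilin_rel y -> bilin_rel (x + y)
| bilin_relZ (a : K) x : bilin_rel x -> bilin_rel (a *: x).

Definition bilin_relb : free -> bool := fun x => `[< bilin_rel x >].

Lemma bilin_relB x y : bilin_rel x -> bilin_rel y -> bilin_rel (x - y).
Proof.
by move=> hx hy; rewrite -scaleN1r; apply: bilin_relD => //; apply: bilin_relZ.
Qed.

Lemma bilin_relb_zmod_closed : zmod_closed bilin_relb.
Proof.
split; first by apply/asboolP; apply: bilin_rel0.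
by move=> x y /asboolP hx /asboolP hy; apply/asboolP; apply: bilin_relB.
Qed.

HB.instance Definition _ :=
  GRing.isZmodClosed.Build free bilin_relb bilin_relb_zmod_closed.

Definition bilin_submod : zmodClosed free :=
  GRing.ZmodClosed.clone _ bilin_relb _.

Definition tensor : Type := {ideal_quot bilin_submod}.

HB.instance Definition _ := GRing.Zmodule.on tensor.

Definition tensor_pi : free -> tensor := \pi_{ideal_quot bilin_submod}.

Lemma tensor_piP x y : tensor_pi x = tensor_pi y <-> bilin_rel (x - y).
Proof.
split=> [/eqP|h]; first by rewrite -Quotient.idealrBE => /asboolP.
by apply/eqP; rewrite -Quotient.idealrBE; apply/asboolP.
Qed.

Lemma tensor_piD x y : tensor_pi (x + y) = tensor_pi x + tensor_pi y.
Proof. exact: (raddfD \pi_{ideal_quot bilin_submod}). Qed.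

Lemma tensor_piK (t : tensor) : tensor_pi (repr (t : {ideal_quot bilin_submod})) = t.
Proof. exact: reprK. Qed.

Definition tensor_scale (a : K) (t : tensor) : tensor :=
  tensor_pi (a *: repr (t : {ideal_quot bilin_submod})).

Lemma tensor_piZ a x : tensor_pi (a *: x) = tensor_scale a (tensor_pi x).
Proof.
apply/tensor_piP; rewrite -scalerBr; apply: bilin_relZ.
by apply/tensor_piP; rewrite tensor_piK.
Qed.

Lemma tensor_scaleA a b t :
  tensor_scale a (tensor_scale b t) = tensor_scale (a * b) t.
Proof. by rewrite -[t]tensor_piK -!tensor_piZ scalerA. Qed.

Lemma tensor_scale1 : left_id 1 tensor_scale.
Proof. by move=> t; rewrite -[t]tensor_piK -!tensor_piZ scale1r. Qed.

Lemma tensor_scaleDr : right_distributive tensor_scale +%R.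
Proof.
move=> a s t; rewrite -[s]tensor_piK -[t]tensor_piK.
by rewrite -!tensor_piZ -!tensor_piD -tensor_piZ scalerDr.
Qed.

Lemma tensor_scaleDl t : {morph tensor_scale^~ t : a b / a + b}.
Proof.
by move=> a b; rewrite -[t]tensor_piK -!tensor_piZ -tensor_piD scalerDl.
Qed.

HB.instance Definition _ := GRing.Zmodule_isLmodule.Build K tensor
  tensor_scaleA tensor_scale1 tensor_scaleDr tensor_scaleDl.

Lemma tensor_pi_linear : linear tensor_pi.
Proof. by move=> a x y; rewrite tensor_piD tensor_piZ. Qed.

Definition tens (v : V) (w : W) : tensor := tensor_pi (gen v w).

Lemma tensDl v v' w : tens (v + v') w = tens v w + tens v' w.
Proof.
by rewrite -tensor_piD; apply/tensor_piP; rewrite opprD addrA; exact: bilin_rel_addl.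
Qed.

Lemma tensDr v w w' : tens v (w + w') = tens v w + tens v w'.
Proof.
by rewrite -tensor_piD; apply/tensor_piP; rewrite opprD addrA; exact: bilin_rel_addr.
Qed.

Lemma tensZl a v w : tens (a *: v) w = a *: tens v w.
Proof.
apply: etrans (tensor_piZ a (gen v w)); apply/tensor_piP.
exact: bilin_rel_scalel.
Qed.

Lemma tensZr a v w : tens v (a *: w) = a *: tens v w.
Proof.
apply: etrans (tensor_piZ a (gen v w)); apply/tensor_piP.
exact: bilin_rel_scaler.
Qed.

Definition bilinear_fun (U : lmodType K) (F : V -> W -> U) : Prop :=
  (forall w, linear (F^~ w)) /\ (forall v, linear (F v)).

(* Sweedler summation: if t is the class of \sum_i c_i v_i (x) w_i, then
   sweedler F t is \sum_i c_i F v_i w_i.  When F is bilinear the value does not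
   depend on the representative, and [sweedler F] is the linear map induced by
   F; F is only used bilinear below. *)
Definition sweedler (U : lmodType K) (F : V -> W -> U) (t : tensor) : U :=
  fglift (fun p => F p.1 p.2) (repr (t : {ideal_quot bilin_submod})).

Section SweedlerBilinear.
Variables (U : lmodType K) (F : V -> W -> U).
Hypothesis bF : bilinear_fun F.

Let f (p : V * W) := F p.1 p.2.

Lemma fglift_scale (a : K) (x : free) : fglift f (a *: x) = a *: fglift f x.
Proof.
have -> : a *: x = \sum_(z <- dom x) Freeg [:: (a * coeff z x, z)].
  rewrite -{1}[x]freeg_sumE scaler_sumr; apply: eq_bigr => z _.
  apply/eqP/freeg_eqP => y.
  by rewrite coeffZ !coeffU mulrA.
rewrite -{3}[x]freeg_sumE !raddf_sum; apply: eq_bigr => z _ /=.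
by rewrite !liftU scalerA.
Qed.

Lemma fglift_rel x : bilin_rel x -> fglift f x = 0.
Proof.
have [bl br] := bF.
elim=> {x} [v v' w|v w w'|a v w|a v w||x y _ hx _ hy|a x _ hx].
- rewrite !raddfB /= !liftU !scale1r /f /=.
  by have := bl w 1 v v'; rewrite !scale1r => ->; rewrite addrAC addrK subrr.
- rewrite !raddfB /= !liftU !scale1r /f /=.
  by have := br v 1 w w'; rewrite !scale1r => ->; rewrite addrAC addrK subrr.
- rewrite raddfB /= fglift_scale !liftU !scale1r /f /=.
  have h0 : F 0 w = 0 by have := bl w (-1) 0 0; rewrite scaler0 addr0 scaleN1r addNr.
  by have := bl w a v 0; rewrite h0 !addr0 => ->; rewrite subrr.
- rewrite raddfB /= fglift_scale !liftU !scale1r /f /=.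
  have h0 : F v 0 = 0 by have := br v (-1) 0 0; rewrite scaler0 addr0 scaleN1r addNr.
  by have := br v a w 0; rewrite h0 !addr0 => ->; rewrite subrr.
- exact: raddf0.
- by rewrite raddfD /= hx hy addr0.
- by rewrite fglift_scale hx scaler0.
Qed.

Lemma sweedler_pi x : sweedler F (tensor_pi x) = fglift f x.
Proof.
apply/eqP; rewrite -subr_eq0 -raddfB; apply/eqP/fglift_rel.
by apply/tensor_piP; rewrite tensor_piK.
Qed.

Lemma sweedler_tens v w : sweedler F (tens v w) = F v w.
Proof. by rewrite sweedler_pi liftU scale1r. Qed.

Lemma sweedler_linear : linear (sweedler F).
Proof.
move=> a s t; rewrite -[s]tensor_piK -[t]tensor_piK -tensor_pi_linear.
by rewrite !sweedler_pi raddfD /= fglift_scale.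
Qed.

End SweedlerBilinear.

Lemma tensor_ext (U : lmodType K) (g h : tensor -> U) :
  linear g -> linear h -> (forall v w, g (tens v w) = h (tens v w)) -> g =1 h.
Proof.
move=> lg lh gh t.
pose G : {linear tensor -> U} := HB.pack g (GRing.isLinear.Build _ _ _ _ g lg).
pose H : {linear tensor -> U} := HB.pack h (GRing.isLinear.Build _ _ _ _ h lh).
pose P : {linear free -> tensor} :=
  HB.pack tensor_pi (GRing.isLinear.Build _ _ _ _ tensor_pi tensor_pi_linear).
rewrite -[g]/(G : _ -> _) -[h]/(H : _ -> _) -[t]tensor_piK.
rewrite -[tensor_pi]/(P : _ -> _) -[repr _]freeg_sumE !linear_sum.
apply: eq_bigr => -[v w] _.
have -> : Freeg [:: (coeff (v, w) (repr (t : {ideal_quot bilin_submod})), (v, w))]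
        = coeff (v, w) (repr (t : {ideal_quot bilin_submod})) *: gen v w.
  by apply/eqP/freeg_eqP => y; rewrite coeffZ !coeffU mul1r.
by rewrite !linearZ /=; congr (_ *: _); apply: gh.
Qed.

End TensorProduct.

Notation "V \ox W" := (tensor V W)
  (at level 40, left associativity) : type_scope.
Notation "v \ot w" := (tens v w)
  (at level 40, left associativity) : ring_scope.
Notation "\sw_ ( v , w <- t ) E" := (sweedler (fun v w => E) t)
  (at level 41, v name, w name, t at level 99, E at level 41,
   format "\sw_ ( v ,  w  <-  t )  E") : ring_scope.

Section TensorMaps.
Variable K : comNzRingType.

Lemma tens_bilinear (V W : lmodType K) : bilinear_fun (@tens K V W).
Proof.
by split=> [w a v v'|v a w w']; rewrite ?tensDl ?tensDr ?tensZl ?tensZr.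
Qed.

Section Map.
Variables (V W V' W' : lmodType K).
Variables (f : {linear V -> V'}) (g : {linear W -> W'}).

Definition tmap (t : V \ox W) : V' \ox W' := \sw_(v, w <- t) (f v \ot g w).

Lemma tmap_bilinear : bilinear_fun (fun v w => f v \ot g w).
Proof.
by split=> [w a v v'|v a w w']; rewrite linearP ?tensDl ?tensDr ?tensZl ?tensZr.
Qed.

HB.instance Definition _ := GRing.isLinear.Build K _ _ _ tmap
  (sweedler_linear tmap_bilinear).

Lemma tmapE v w : tmap (v \ot w) = f v \ot g w.
Proof. by rewrite /tmap (sweedler_tens tmap_bilinear). Qed.

End Map.

Section Swap.
Variables (V W : lmodType K).

Definition tswap (t : V \ox W) : W \ox V := \sw_(v, w <- t) (w \ot v).

Lemma tswap_bilinear : bilinear_fun (fun (v : V) (w : W) => w \ot v).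
Proof.
by split=> [w a v v'|v a w w']; rewrite ?tensDl ?tensDr ?tensZl ?tensZr.
Qed.

HB.instance Definition _ := GRing.isLinear.Build K _ _ _ tswap
  (sweedler_linear tswap_bilinear).

Lemma tswapE v w : tswap (v \ot w) = w \ot v.
Proof. by rewrite /tswap (sweedler_tens tswap_bilinear). Qed.

End Swap.

Section Assoc.
Variables (U V W : lmodType K).

Definition tassoc (t : (U \ox V) \ox W) : U \ox (V \ox W) :=
  \sw_(s, w <- t) \sw_(u, v <- s) (u \ot (v \ot w)).

Definition tassocV (t : U \ox (V \ox W)) : (U \ox V) \ox W :=
  \sw_(u, s <- t) \sw_(v, w <- s) ((u \ot v) \ot w).

Lemma tassoc_bilin1 w : bilinear_fun (fun (u : U) (v : V) => u \ot (v \ot w : V \ox W)).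
Proof.
by split=> [v a u u'|u a v v']; rewrite ?(tensDl, tensDr, tensZl, tensZr).
Qed.

Lemma tassocV_bilin1 u : bilinear_fun (fun (v : V) (w : W) => (u \ot v : U \ox V) \ot w).
Proof.
by split=> [w a v v'|v a w w']; rewrite ?(tensDl, tensDr, tensZl, tensZr).
Qed.

Lemma tassoc_bilinear :
  bilinear_fun (fun (s : U \ox V) (w : W) => \sw_(u, v <- s) (u \ot (v \ot w))).
Proof.
split=> [w|s a w w']; first exact: sweedler_linear (tassoc_bilin1 w).
have lin w0 := sweedler_linear (tassoc_bilin1 w0).
move: s; apply: tensor_ext => [||u v]; first exact: lin.
  by move=> b s s'; rewrite !lin !scalerDr !scalerA [b * a]mulrC addrACA.
rewrite !(sweedler_tens (tassoc_bilin1 _)).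
by rewrite ?(tensDl, tensDr, tensZl, tensZr).
Qed.

Lemma tassocV_bilinear :
  bilinear_fun (fun (u : U) (s : V \ox W) => \sw_(v, w <- s) ((u \ot v) \ot w)).
Proof.
split=> [s a u u'|u]; last exact: sweedler_linear (tassocV_bilin1 u).
have lin u0 := sweedler_linear (tassocV_bilin1 u0).
move: s; apply: tensor_ext => [||v w]; first exact: lin.
  by move=> b s s'; rewrite !lin !scalerDr !scalerA [b * a]mulrC addrACA.
rewrite !(sweedler_tens (tassocV_bilin1 _)).
by rewrite ?(tensDl, tensDr, tensZl, tensZr).
Qed.

HB.instance Definition _ := GRing.isLinear.Build K _ _ _ tassoc
  (sweedler_linear tassoc_bilinear).
HB.instance Definition _ := GRing.isLinear.Build K _ _ _ tassocV
  (sweedler_linear tassocV_bilinear).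

Lemma tassocE u v w : tassoc ((u \ot v) \ot w) = u \ot (v \ot w).
Proof.
rewrite /tassoc (sweedler_tens tassoc_bilinear).
by rewrite (sweedler_tens (tassoc_bilin1 _)).
Qed.

Lemma tassocVE u v w : tassocV (u \ot (v \ot w)) = (u \ot v) \ot w.
Proof.
rewrite /tassocV (sweedler_tens tassocV_bilinear).
by rewrite (sweedler_tens (tassocV_bilin1 _)).
Qed.

End Assoc.

Lemma iter_linear (V : lmodType K) (f : {linear V -> V}) n : linear (iter n f).
Proof. by elim: n => [|n IHn] a u v //=; rewrite IHn linearP. Qed.

HB.instance Definition _ (V : lmodType K) (f : {linear V -> V}) (n : nat) :=
  GRing.isLinear.Build K V V _ (iter n f) (iter_linear f n).

End TensorMaps.

Arguments tswap {K} V W t.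
Arguments tassoc {K} U V W t.
Arguments tassocV {K} U V W t.

Notation "f \tx g" := (tmap f g)
  (at level 40, left associativity) : ring_scope.

Section HomBialgebras.
Variables (K : comNzRingType) (H : lmodType K).

(* Id (x) tau (x) Id on H^{(x) 4}, both ends bracketed as pairs of pairs. *)
Definition tmid : {linear (H \ox H) \ox (H \ox H) -> (H \ox H) \ox (H \ox H)} :=
  tassocV H H (H \ox H)
    \o (idfun \tx (tassoc H H H \o (tswap H H \tx idfun) \o tassocV H H H))
    \o tassoc H H (H \ox H).

Lemma tmidE a b c d : tmid ((a \ot b) \ot (c \ot d)) = (a \ot c) \ot (b \ot d).
Proof.
by rewrite /= tassocE tmapE /= tassocVE tmapE /= tswapE tassocE tassocVE.
Qed.

(* The associator tassoc, left implicit on paper, identifies the two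
   bracketings of H^{(x) 3}. *)
Record hom_associative_algebra (mu : {linear H \ox H -> H})
    (alpha : {linear H -> H}) : Prop := {
  hom_mulM : alpha \o mu =1 mu \o (alpha \tx alpha);
  hom_mulA : mu \o (alpha \tx mu) \o tassoc H H H =1 mu \o (mu \tx alpha) }.

Record hom_coassociative_coalgebra (Delta : {linear H -> H \ox H})
    (alpha : {linear H -> H}) : Prop := {
  hom_comulM : (alpha \tx alpha) \o Delta =1 Delta \o alpha;
  hom_comulA : (alpha \tx Delta) \o Delta
                 =1 tassoc H H H \o (Delta \tx alpha) \o Delta }.

Record hom_bialgebra (mu : {linear H \ox H -> H}) (Delta : {linear H -> H \ox H})
    (alpha : {linear H -> H}) : Prop := {
  hom_bialgebra_alg : hom_associative_algebra mu alpha;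
  hom_bialgebra_coalg : hom_coassociative_coalgebra Delta alpha;
  hom_bialgebraM :
    Delta \o mu =1 (mu \tx mu) \o tmid \o (Delta \tx Delta) }.

Record cobraided_hom_bialgebra (mu : {linear H \ox H -> H})
    (Delta : {linear H -> H \ox H}) (alpha : {linear H -> H})
    (R : {scalar H \ox H}) : Prop := {
  cobraided_bialgebra : hom_bialgebra mu Delta alpha;
  cobraided_mull : forall x y z : H,
    R (mu (x \ot y) \ot alpha z)
    = \sw_(z1, z2 <- Delta z) (R (alpha x \ot z1) * R (alpha y \ot z2) : K^o);
  cobraided_mulr : forall x y z : H,
    R (alpha x \ot mu (y \ot z))
    = \sw_(x1, x2 <- Delta x) (R (x1 \ot alpha z) * R (x2 \ot alpha y) : K^o);
  cobraided_swap : forall x y : H,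
    \sw_(x1, x2 <- Delta x) \sw_(y1, y2 <- Delta y)
      (R (x2 \ot y2) *: mu (y1 \ot x1))
    = \sw_(x1, x2 <- Delta x) \sw_(y1, y2 <- Delta y)
      (R (x1 \ot y1) *: mu (x2 \ot y2)) }.

Definition twist_mul (mu : {linear H \ox H -> H}) (alpha : {linear H -> H})
    (n : nat) : {linear H \ox H -> H} :=
  iter (2 ^ n - 1) alpha \o mu.

Definition twist_comul (Delta : {linear H -> H \ox H}) (alpha : {linear H -> H})
    (n : nat) : {linear H -> H \ox H} :=
  Delta \o iter (2 ^ n - 1) alpha.

Definition twist_form (R : {scalar H \ox H}) (alpha : {linear H -> H})
    (k : nat) : {scalar H \ox H} :=
  R \o (iter k alpha \tx iter k alpha).

End HomBialgebras.

(* Main.v *)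
Require Import Defs.
From mathcomp Require Import all_boot all_algebra.
From mathcomp Require Import freeg.

Set Implicit Arguments.
Unset Strict Implicit.
Unset Printing Implicit Defensive.

Import GRing.Theory.
Local Open Scope ring_scope.

(** Both parts are statements about an endomorphism [beta] of the Hom-bialgebra,
    that is, a linear map that commutes with [mu], [Delta] and [alpha]; every
    power of [alpha] is one.

    Replacing [mu], [Delta], [alpha] by [beta \o mu], [Delta \o beta],
    [alpha \o beta] and keeping [R] preserves all the axioms
    ([cobraided_hom_bialgebra_twist]).  As [beta] can be moved across every
    operation, each Hom-bialgebra axiom of the new structure is the old one
    composed with two copies of [beta].  The new multiplicativity axioms for [R] at
    [x, y, z] are the old ones at [beta x, beta y, beta z], and the new
    commutation axiom at [x, y] is the image under [beta] of the old one at
    [beta x, beta y].  Part (1) is the case [beta = alpha^(2^n - 1)].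

    Replacing [R] by [R \o (beta \tx beta)] and keeping the Hom-bialgebra
    preserves the axioms when [beta] is injective
    ([cobraided_hom_bialgebra_form]).  Since [Delta (beta x)] is the image of
    [Delta x] under [beta \tx beta], the multiplicativity axioms at [x, y, z]
    are again the old ones at [beta x, beta y, beta z].  The commutation axiom
    becomes the old one at [beta x, beta y] only after [beta] has been applied
    to both sides, and injectivity removes that [beta].  Part (2) follows by
    twisting [R] by [alpha^k] first, then the whole structure as in part (1). *)

(** * Sweedler sums *)

Section Sweedler.
Variables (K : comNzRingType) (V W : lmodType K).

(** On a fixed representative a Sweedler sum is an honest finite linear
    combination of values of [F].  Hence everything that is linear passes
    through it, whether or not [F] is bilinear. *)
Lemma sweedler_sum (U : lmodType K) (F : V -> W -> U) (t : V \ox W) :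
  let x := repr (t : {ideal_quot bilin_submod V W}) in
  sweedler F t = \sum_(p <- dom x) coeff p x *: F p.1 p.2.
Proof.
rewrite /= /sweedler; set x := repr _.
rewrite -{1}[x]freeg_sumE raddf_sum; apply: eq_bigr => p _ /=.
by rewrite liftU.
Qed.

Lemma eq_sweedler (U : lmodType K) (F G : V -> W -> U) (t : V \ox W) :
  F =2 G -> sweedler F t = sweedler G t.
Proof.
by move=> FG; rewrite !sweedler_sum; apply: eq_bigr => p _; rewrite FG.
Qed.

Lemma linear_sweedler (U U' : lmodType K) (g : {linear U -> U'})
    (F : V -> W -> U) (t : V \ox W) :
  g (sweedler F t) = \sw_(v, w <- t) g (F v w).
Proof.
rewrite !sweedler_sum linear_sum; apply: eq_bigr => p _.
by rewrite linearZ.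
Qed.

Lemma sweedler_linear_param (P U : lmodType K) (F : P -> V -> W -> U)
    (t : V \ox W) :
  (forall v w, linear (fun p => F p v w)) -> linear (fun p => sweedler (F p) t).
Proof.
move=> lF a p q; rewrite !sweedler_sum scaler_sumr -big_split /=.
apply: eq_bigr => z _.
by rewrite lF scalerDr !scalerA mulrC.
Qed.

Lemma sweedler_bilinear_param (P Q U : lmodType K)
    (F : P -> Q -> V -> W -> U) (t : V \ox W) :
  (forall v w, bilinear_fun (fun p q => F p q v w)) ->
  bilinear_fun (fun p q => sweedler (F p q) t).
Proof.
move=> bF; split=> [q|p].
  by apply: (@sweedler_linear_param _ _ (F^~ q)) => v w; case: (bF v w).
by apply: sweedler_linear_param => v w; case: (bF v w).
Qed.

(** Change of variables along [f \tx g]; bilinearity of [F] matters because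
    the image of a representative need not be the chosen one. *)
Lemma sweedler_tmap (V' W' U : lmodType K) (f : {linear V -> V'})
    (g : {linear W -> W'}) (F : V' -> W' -> U) (t : V \ox W) :
  bilinear_fun F -> sweedler F ((f \tx g) t) = \sw_(v, w <- t) F (f v) (g w).
Proof.
move=> bF; have [lF rF] := bF.
have bFfg : bilinear_fun (fun v w => F (f v) (g w)).
  by split=> [w a v v'|v a w w']; rewrite linearP ?lF ?rF.
move: t; apply: tensor_ext => [a s t||v w].
- by rewrite linearP (sweedler_linear bF).
- exact: sweedler_linear.
- by rewrite tmapE !sweedler_tens.
Qed.

End Sweedler.

Lemma tmap_ext (K : comNzRingType) (V W V' W' : lmodType K)
    (f f' : {linear V -> V'}) (g g' : {linear W -> W'}) :
  f =1 f' -> g =1 g' -> f \tx g =1 f' \tx g'.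
Proof. by move=> ff gg t; apply: eq_sweedler => v w; rewrite ff gg. Qed.

Lemma tmap_comp (K : comNzRingType) (V W V' W' V'' W'' : lmodType K)
    (f : {linear V -> V'}) (g : {linear W -> W'})
    (f' : {linear V' -> V''}) (g' : {linear W' -> W''}) (t : V \ox W) :
  ((f' \o f) \tx (g' \o g)) t = (f' \tx g') ((f \tx g) t).
Proof.
by rewrite [RHS]sweedler_tmap //; exact: tmap_bilinear.
Qed.

Lemma tmap_id (K : comNzRingType) (V W : lmodType K) (f : {linear V -> V})
    (g : {linear W -> W}) :
  f =1 id -> g =1 id -> f \tx g =1 id.
Proof.
move=> fE gE; apply: tensor_ext => [||v w]; last by rewrite tmapE fE gE.
  exact: linearP.
by [].
Qed.

Lemma tmap_iter (K : comNzRingType) (V W : lmodType K) (f : {linear V -> V})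
    (g : {linear W -> W}) n :
  iter n f \tx iter n g =1 iter n (f \tx g).
Proof.
elim: n => [|n IHn] t; first exact: tmap_id.
by rewrite iterS -IHn -tmap_comp; apply: tmap_ext.
Qed.

Section Bilinearity.
Variables (K : comNzRingType) (V W U : lmodType K).

Lemma linear_tensl (f : V \ox W -> U) (w : W) :
  linear f -> linear (fun v => f (v \ot w)).
Proof. by move=> lf a v v'; rewrite tensDl tensZl lf. Qed.

Lemma linear_tensr (f : V \ox W -> U) (v : V) :
  linear f -> linear (fun w => f (v \ot w)).
Proof. by move=> lf a w w'; rewrite tensDr tensZr lf. Qed.

Lemma scale_bilinear (f : V -> K^o) (g : W -> U) :
  linear f -> linear g -> bilinear_fun (fun v w => f v *: g w).
Proof.
move=> lf lg; split=> [w a v v'|v a w w'].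
  by rewrite lf scalerDl scalerA.
by rewrite lg scalerDr !scalerA mulrC.
Qed.

End Bilinearity.

Lemma bilinear_funC (K : comNzRingType) (V W U : lmodType K)
    (F : V -> W -> U) :
  bilinear_fun F -> bilinear_fun (fun w v => F v w).
Proof. by case. Qed.

(** * Endomorphisms of a Hom-bialgebra *)

Section Twist.
Variables (K : comNzRingType) (H : lmodType K).
Implicit Types (mu : {linear H \ox H -> H}) (Delta : {linear H -> H \ox H}).
Implicit Types (alpha beta : {linear H -> H}) (R : {scalar H \ox H}).

Record hom_endomorphism mu Delta alpha beta : Prop := {
  hom_endoM : beta \o mu =1 mu \o (beta \tx beta);
  hom_endo_comul : (beta \tx beta) \o Delta =1 Delta \o beta;
  hom_endo_comm : beta \o alpha =1 alpha \o beta }.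

Lemma iter_hom_endomorphism mu Delta alpha n :
  hom_bialgebra mu Delta alpha ->
  hom_endomorphism mu Delta alpha (iter n alpha).
Proof.
move=> [[mulM _] [comulM _] _]; split=> [t|x|x] /=; last by rewrite -iterSr.
- rewrite tmap_iter.
  by elim: n t => //= n IHn t; rewrite IHn; exact: mulM.
- rewrite tmap_iter.
  by elim: n x => //= n IHn x; rewrite IHn; exact: comulM.
Qed.

(** * The two kinds of twist *)

(** Each new axiom is the old one precomposed or postcomposed with two copies
    of [beta].  The third map is a variable [alpha'] because the iterates of
    [alpha] agree with [alpha \o beta] pointwise only. *)
Lemma hom_bialgebra_twist mu Delta alpha beta alpha' :
  hom_bialgebra mu Delta alpha -> hom_endomorphism mu Delta alpha beta ->
  alpha' =1 alpha \o beta ->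
  hom_bialgebra (beta \o mu) (Delta \o beta) alpha'.
Proof.
move=> [[mulM mulA] [comulM comulA] bialgM] [bM bD bC] alE.
have mulM' t : alpha (mu t) = mu ((alpha \tx alpha) t) by exact: mulM.
have bM' t : beta (mu t) = mu ((beta \tx beta) t) by exact: bM.
have bD' x : (beta \tx beta) (Delta x) = Delta (beta x) by exact: bD.
have bC' x : beta (alpha x) = alpha (beta x) by exact: bC.
have comulM' x : (alpha \tx alpha) (Delta x) = Delta (alpha x) by exact: comulM.
have bialgM' t : (mu \tx mu) (tmid _ ((Delta \tx Delta) t)) = Delta (mu t).
  exact: esym (bialgM t).
have alE' x : alpha' x = beta (alpha x) by rewrite alE /= bC'.
split=> [||t /=]; [split=> t /= | split=> t /= | ].
- rewrite alE' (tmap_ext (f' := beta \o alpha) (g' := beta \o alpha) alE' alE').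
  by rewrite tmap_comp -bM' bC' -mulM' bC'.
- rewrite (tmap_ext (f' := beta \o alpha) (g' := beta \o mu) alE') //.
  rewrite (tmap_ext (f' := beta \o mu) (g' := beta \o alpha) _ alE') //.
  by rewrite !tmap_comp -!bM'; congr (beta (beta _)); exact: mulA.
- rewrite (tmap_ext (f' := alpha \o beta) (g' := alpha \o beta) alE alE)
    tmap_comp bD' comulM'.
  by rewrite alE /= bC'.
- rewrite (tmap_ext (f' := alpha \o beta) (g' := Delta \o beta) alE) //.
  rewrite (tmap_ext (f' := Delta \o beta) (g' := alpha \o beta) _ alE) //.
  by rewrite !tmap_comp bD'; exact: comulA.
- by rewrite !tmap_comp bialgM' bD' !bM'.
Qed.

(** [R] itself need not change: [Delta \o beta] evaluates its axioms at
    [beta]-images, and the [beta] in front of [mu] is absorbed by [mu] in the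
    multiplicativity axioms and common to both sides in the commutation one. *)
Lemma cobraided_hom_bialgebra_twist mu Delta alpha beta alpha' R :
  cobraided_hom_bialgebra mu Delta alpha R ->
  hom_endomorphism mu Delta alpha beta -> alpha' =1 alpha \o beta ->
  cobraided_hom_bialgebra (beta \o mu) (Delta \o beta) alpha' R.
Proof.
move=> [bialg Rmull Rmulr Rswap] endo alE; have [bM _ _] := endo.
have bM' x y : beta (mu (x \ot y)) = mu (beta x \ot beta y).
  by rewrite [LHS]bM /= tmapE.
split=> [|x y z|x y z|x y] /=; first exact: hom_bialgebra_twist endo alE.
- by rewrite !alE /= bM' Rmull.
- by rewrite !alE /= bM' Rmulr.
have := congr1 beta (Rswap (beta x) (beta y)).
rewrite !linear_sweedler => E.
by etransitivity; [|etransitivity; [exact: E|]]; apply: eq_sweedler => x1 x2;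
  rewrite linear_sweedler; apply: eq_sweedler => y1 y2; rewrite linearZ.
Qed.

(** Injectivity enters only through the commutation axiom: its sides take values
    in [H], and the old axiom controls them only after [beta] is applied. *)
Lemma cobraided_hom_bialgebra_form mu Delta alpha beta R :
  cobraided_hom_bialgebra mu Delta alpha R ->
  hom_endomorphism mu Delta alpha beta -> injective beta ->
  cobraided_hom_bialgebra mu Delta alpha (R \o (beta \tx beta)).
Proof.
move=> [bialg Rmull Rmulr Rswap] [bM bD bC] beta_inj.
have bM' x y : beta (mu (x \ot y)) = mu (beta x \ot beta y).
  by rewrite [LHS]bM /= tmapE.
have bD' x : Delta (beta x) = (beta \tx beta) (Delta x) by rewrite [RHS]bD.
have bC' x : beta (alpha x) = alpha (beta x) by exact: bC.
have lR : linear (R : _ -> K^o) by exact: linearP.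
have lmu : linear mu by exact: linearP.
split=> // [x y z|x y z|x y] /=.
- rewrite tmapE bM' bC' Rmull bD' sweedler_tmap.
    by apply: (eq_sweedler (U := K^o)) => z1 z2; rewrite !tmapE !bC'.
  by apply: (scale_bilinear (U := K^o)); exact: linear_tensr.
- rewrite tmapE bM' bC' Rmulr bD' sweedler_tmap.
    by apply: (eq_sweedler (U := K^o)) => x1 x2; rewrite !tmapE !bC'.
  by apply: (scale_bilinear (U := K^o)); exact: linear_tensl.
(* The form sees [beta]-images already.  Once [beta] is applied to the sums,
   so does [mu], and all four Sweedler variables can be read off
   [Delta (beta x)] and [Delta (beta y)]. *)
have push (F : H -> H -> H -> H -> H) :
    (forall y1 y2, bilinear_fun (fun x1 x2 => F x1 x2 y1 y2)) ->
    (forall x1 x2, bilinear_fun (F x1 x2)) ->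
  \sw_(x1, x2 <- Delta (beta x)) \sw_(y1, y2 <- Delta (beta y)) F x1 x2 y1 y2
  = \sw_(x1, x2 <- Delta x) \sw_(y1, y2 <- Delta y)
      F (beta x1) (beta x2) (beta y1) (beta y2).
  move=> bFx bFy; rewrite !bD' sweedler_tmap; last exact: sweedler_bilinear_param.
  by apply: eq_sweedler => x1 x2; rewrite sweedler_tmap.
apply: beta_inj.
have := Rswap (beta x) (beta y).
rewrite push; first last.
- by move=> x1 x2; apply: bilinear_funC; apply: scale_bilinear;
    [exact: linear_tensr | exact: linear_tensl].
- by move=> y1 y2; apply: bilinear_funC; apply: scale_bilinear;
    [exact: linear_tensl | exact: linear_tensr].
rewrite push; first last.
- by move=> x1 x2; apply: scale_bilinear; exact: linear_tensr.
- by move=> y1 y2; apply: scale_bilinear; exact: linear_tensl.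
move=> E; rewrite !linear_sweedler.
by etransitivity; [|etransitivity; [exact: E|]]; apply: eq_sweedler => x1 x2;
  rewrite linear_sweedler; apply: eq_sweedler => y1 y2;
  rewrite linearZ /= tmapE bM'.
Qed.

End Twist.

Theorem theorem3p6 (K : comNzRingType)
    (charK0 : forall m : nat, m%:R = 0 :> K -> m = 0%N)
    (H : lmodType K) (mu : {linear H \ox H -> H})
    (Delta : {linear H -> H \ox H}) (alpha : {linear H -> H})
    (R : {scalar H \ox H}) :
  cobraided_hom_bialgebra mu Delta alpha R ->
  (forall n : nat,
     cobraided_hom_bialgebra (twist_mul mu alpha n) (twist_comul Delta alpha n)
       (iter (2 ^ n) alpha) R) /\
  (injective alpha ->
   forall n k : nat,
     cobraided_hom_bialgebra (twist_mul mu alpha n) (twist_comul Delta alpha n)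
       (iter (2 ^ n) alpha) (twist_form R alpha k)).
Proof.
have twist n (Q : {scalar H \ox H}) : cobraided_hom_bialgebra mu Delta alpha Q ->
  cobraided_hom_bialgebra (twist_mul mu alpha n) (twist_comul Delta alpha n)
    (iter (2 ^ n) alpha) Q.
  move=> cobr; apply: (cobraided_hom_bialgebra_twist cobr) => [|x] /=.
    by apply: iter_hom_endomorphism; case: cobr.
  by rewrite -iterS -subSn ?expn_gt0 // subn1.
move=> cobr; split=> [n|alpha_inj n k]; first exact: twist.
apply/twist/(cobraided_hom_bialgebra_form cobr).
  by apply: iter_hom_endomorphism; case: cobr.
by elim: k => //= k IHk x y /alpha_inj /IHk.
Qed.
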